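(* Let $\mathcal{A}$ be a central hyperplane arrangement defined over a field of characteristic zero. Then $$\mathsf{mfHP}_{\mathcal{A}}\big(X^{-1},(T_x^{-1})_{x\in\mathcal{L}(\mathcal{A})}\big)=-(-X)^{-\mathrm{rk}(\mathcal{A})}\,T_{\hat 1}\,\mathsf{mfHP}_{\mathcal{A}}\big(X,(T_x)_{x\in\mathcal{L}(\mathcal{A})}\big).$$
   Context: A hyperplane arrangement $\mathcal{A}$ over a field $K$ is a finite set of affine hyperplanes in $K^d$. Its intersection poset $\mathcal{L}(\mathcal{A})$ consists of all non-empty intersections of hyperplanes of $\mathcal{A}$ together with $\hat 0=K^d$, ordered by reverse inclusion and ranked by codimension, $\mathrm{rk}$. It is central if $\bigcap_{H\in\mathcal{A}}H\ne\varnothing$; then $\mathcal{L}(\mathcal{A})$ has top element $\hat 1=\bigcap_{H\in\mathcal{A}}H$, and $\mathrm{rk}(\mathcal{A})=\mathrm{rk}(\hat 1)$. The Poincaré polynomial is $\pi_{\mathcal{A}}(t)=\sum_{x\in\mathcal{L}(\mathcal{A})}\mu(x)(-t)^{\mathrm{rk}(x)}$, with $\mu(x)=\mu(\hat 0,x)$ the Möbius function of $\mathcal{L}(\mathcal{A})$. For $x\in\mathcal{L}(\mathcal{A})$ put $\mathcal{A}_x=\{H\in\mathcal{A}:H\supseteq x\}$, and let $\mathcal{A}^x=\{H\cap x: H\in\mathcal{A}\setminus\mathcal{A}_x,\ H\cap x\neq\varnothing\}$, an arrangement in $x$; set $\mathcal{A}_{\varnothing}=\mathcal{A}$ and $\mathcal{A}_x^y=(\mathcal{A}_x)^y$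 for $y\le x$. The empty arrangement has Poincaré polynomial $1$. $\Delta(\mathcal{L}(\mathcal{A}))$ is the set of flags (chains) $F=(x_1<\dots<x_l)$ in $\mathcal{L}(\mathcal{A})$, including the empty flag. Put $\pi_F(X)=\prod_{i=0}^{l}\pi_{\mathcal{A}_{x_{i+1}}^{x_i}}(X)$ with $x_0=\hat 0$, $x_{l+1}=\varnothing$. Let $\min(F)=x_1$ for non-empty $F$ and $\min(\varnothing)=\varnothing$, and set $\underline{\pi}_F(X)=\pi_F(X)/\pi_{\mathcal{A}_{\min(F)}}(X)\in\mathbb{Z}[X]$. The truncated flag Hilbert–Poincaré series is the rational function $\mathsf{mfHP}_{\mathcal{A}}(X,(T_x)_{x\in\mathcal{L}(\mathcal{A})})=\sum_{F\in\Delta(\mathcal{L}(\mathcal{A}))}\underline{\pi}_F(X)\prod_{x\in F}\frac{T_x}{1-T_x}$ in indeterminates $X$ and $T_x$. *)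

(* Defs.v *)
From HB Require Import structures.
From mathcomp Require Import all_boot all_order all_algebra.
From mathcomp Require Import finmap boolp classical_sets.
From mathcomp Require Import mpoly.

Set Implicit Arguments.
Unset Strict Implicit.
Unset Printing Implicit Defensive.

Import Order.TTheory GRing.Theory Num.Theory.

Local Open Scope fset_scope.
Local Open Scope classical_set_scope.
Local Open Scope ring_scope.

Section Mobius.
Context {disp : Order.disp_t} {T : porderType disp}.
Implicit Types (L : {fset T}) (a b : T).

(* The number n only bounds the depth of the recursion; by [mobiusE] the bound
   used in [mobius] is large enough. *)
Fixpoint mobius_rec L a (n : nat) b : int :=
  if n is n'.+1 then
    if b == a then 1
    else - \sum_(z <- L | (a <= z < b)%O) mobius_rec L a n' z
  else 0.

Definition mobius L a b : int := mobius_rec L a #|` L| b.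

Lemma mobius_rec_stable L a n m b :
  (#|` [fset z in L | (z < b)%O]| < n)%N ->
  (#|` [fset z in L | (z < b)%O]| < m)%N ->
  mobius_rec L a n b = mobius_rec L a m b.
Proof.
elim: n m b => [|n IH] [|m] b //= ltn ltm; case: eqP => // _.
congr (- _); rewrite big_seq_cond [RHS]big_seq_cond.
apply: eq_bigr => z /and3P[zL _ zb].
have lt_card : (#|` [fset y in L | (y < z)%O]| < #|` [fset y in L | (y < b)%O]|)%N.
  apply: fproper_ltn_card; rewrite fproperEneq; apply/andP; split.
    apply/eqP => E; have : z \in [fset y in L | (y < b)%O] by rewrite !inE zL.
    by rewrite -E !inE ltxx andbF.
  by apply/fsubsetP => y; rewrite !inE => /andP[-> /lt_trans]; apply.
by apply: IH; apply: leq_trans lt_card _.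
Qed.

Lemma mobiusE L a b : b \in L ->
  mobius L a b = if b == a then 1
                 else - \sum_(z <- L | (a <= z < b)%O) mobius L a z.
Proof.
have card_lt x : x \in L -> (#|` [fset z in L | (z < x)%O]| < #|` L|)%N.
  move=> xL; apply: fproper_ltn_card; rewrite fproperEneq; apply/andP; split.
    by apply/eqP => E; move: xL; rewrite -E !inE ltxx andbF.
  by apply/fsubsetP => y; rewrite !inE => /andP[].
move=> bL; rewrite {1}/mobius (@mobius_rec_stable _ _ _ #|` L|.+1) ?card_lt //.
exact: leqW (card_lt _ bL).
Qed.

End Mobius.

Section Arrangement.
Context {K : fieldType} {d : nat}.

(* The sets of points of K^d, ordered by reverse inclusion. *)
Local Notation revset := ((set 'rV[K]_d)^d)%type.

Implicit Types (E x y H : set 'rV[K]_d) (A : {fset set 'rV[K]_d}).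

Definition flat (p : 'rV[K]_d) (W : {vspace 'rV[K]_d}) : set 'rV[K]_d :=
  [set v | v - p \in W].

Definition affdim x : nat :=
  xget 0%N [set n | exists p W, x = flat p W /\ n = \dim W].

Lemma affdim_flat p W : affdim (flat p W) = \dim W.
Proof.
rewrite /affdim; case: xgetP => [n _ [q [U [E ->]]]|]; last first.
  by move=> /(_ (\dim W)) []; exists p, W.
have memE v : (v - p \in W) = (v - q \in U).
  by apply/idP/idP; have /(congr1 (fun S => S v)) := E; rewrite /flat /= => ->.
congr (\dim _); apply/vspaceP => w.
have pq : p - q \in U by rewrite -memE subrr mem0v.
have := memE (w + p); rewrite addrK => ->.
by rewrite -addrA rpredDr.
Qed.

(* The codimension of x in E, for x contained in E. *)
Definition codim E x : nat := (affdim E - affdim x)%N.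

Definition hyperplane H : Prop := exists p W, H = flat p W /\ (\dim W).+1 = d.

Definition arrangement A : Prop := forall H, H \in A -> hyperplane H.

Definition hcap A : set 'rV[K]_d := \bigcap_(H in [set` A]) H.

(* The intersection poset of an arrangement A in the affine space E;
   the subset B = fset0 contributes its bottom element E. *)
Definition intposet E A : {fset revset} :=
  [fset x in [fset E `&` hcap B | B in fpowerset A] | x != set0].

Definition poincare E A : {poly int} :=
  \sum_(x <- intposet E A)
    (mobius (intposet E A) (E : revset) x)%:P * (- 'X) ^+ codim E x.

(* As every H contains set0, localization A set0 = A. *)
Definition localization A x : {fset set 'rV[K]_d} := [fset H in A | `[< x `<=` H >]].

Definition restriction A x : {fset set 'rV[K]_d} :=
  [fset H `&` x | H in (A `\` localization A x)%fset & H `&` x != set0].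

Local Notation lat A := (intposet setT A).

Definition is_flag A (F : {set lat A}) : bool :=
  [forall x in F, forall y in F,
    (\val x <= \val y)%O || (\val y <= \val x)%O].

(* The elements x_1 < ... < x_l of the flag F. *)
Definition flag_seq A (F : {set lat A}) : seq (set 'rV[K]_d) :=
  sort (<=%O : rel revset) (map val (enum F)).

Definition flag_min A (F : {set lat A}) : set 'rV[K]_d := head set0 (flag_seq F).

Definition flag_poincare A (F : {set lat A}) : {poly int} :=
  let x := nth set0 (setT :: rcons (flag_seq F) set0) in
  \prod_(i < #|F|.+1)
    poincare (x i) (restriction (localization A (x i.+1)) (x i)).

(* The denominator below does not vanish when X is an indeterminate or its
   inverse, since a Poincare polynomial has constant coefficient 1. *)
Definition trunc_flag_poincare A (Q : fieldType) (F : {set lat A}) (X : Q) : Q :=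
  (map_poly intr (flag_poincare F)).[X] /
  (map_poly intr (poincare setT (localization A (flag_min F)))).[X].

Definition mfHP A (Q : fieldType) (X : Q) (T : lat A -> Q) : Q :=
  \sum_(F : {set lat A} | is_flag F)
    trunc_flag_poincare F X * \prod_(x in F) (T x / (1 - T x)).

Definition central A : Prop := hcap A !=set0.

Lemma hcap_intposet A : central A -> hcap A \in lat A.
Proof.
move=> /set0P cA; rewrite !inE /= cA andbT; apply/imfsetP; exists A => /=.
  by rewrite fpowersetE fsubset_refl.
by rewrite setTI.
Qed.

Definition arr_top A (cA : central A) : lat A := FSetSub (hcap_intposet cA).

Definition arr_rank A : nat := codim setT (hcap A).

(* The field of rational functions in X and the T_x. *)
Definition ratfun A : fieldType := {fraction {mpoly int[#|{: lat A}|.+1]}}.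

Definition varX A : ratfun A := tofrac 'X_ord0.

Definition varT A (x : lat A) : ratfun A := tofrac 'X_(lift ord0 (enum_rank x)).

End Arrangement.

(* Main.v *)
(* Put u_x = T_x / (1 - T_x), D x = (-X)^(rk x) and, for x <= y,
   P(x, y) = pi_[x, y](X).  If a y is the sum over the chains
   x_1 < ... < x_l < y of P(x_1, x_2) ... P(x_l, y) u_(x_1) ... u_(x_l), then
   removing the largest element of a chain gives
     a y = 1 + sum_(x < y) a x u_x P(x, y),
   and mfHP = a 1 * (1 + u_1) at the top element 1.  As a matrix,
   P = D^-1 mu D zeta; inverting X turns D into D^-1 and inverting the T_x turns
   u into -1 - u.  Since P D^-1 P' = D^-1, where P' is P at X^-1, the function
   a / D satisfies the recurrence of a at the inverted variables, which
   determines its solution. *)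
Require Import Defs.
From HB Require Import structures.
From mathcomp Require Import all_boot all_order all_algebra.
From mathcomp Require Import finmap boolp classical_sets.
From mathcomp Require Import mpoly ring.

Set Implicit Arguments.
Unset Strict Implicit.
Unset Printing Implicit Defensive.

Import Order.TTheory GRing.Theory.
Local Open Scope ring_scope.

(** * Weighted sums over chains *)

Section ChainWeight.
Context {R : comNzRingType} {S : Type}.
Implicit Types (P : S -> S -> R) (c : S -> R) (s : seq S).

Fixpoint path_weight P c x s : R :=
  if s is y :: s' then P x y * path_weight P c y s' else c x.

(** No factor leads into the first element, as in the truncated polynomial of a flag; [c] closes the
    chain at its upper end. *)
Definition seq_weight P c s : R :=
  if s is x :: s' then path_weight P c x s' else 1.

Lemma path_weight_rcons P c x s y :
  path_weight P c x (rcons s y) = path_weight P (P^~ y) x s * c y.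
Proof. by elim: s x => //= z s IH x; rewrite IH mulrA. Qed.

Lemma seq_weight_rcons P c s y :
  seq_weight P c (rcons s y) = seq_weight P (P^~ y) s * c y.
Proof. by case: s => [|x s] /=; rewrite ?mul1r ?path_weight_rcons. Qed.

(** Links the indexed product in [flag_poincare] to the recursion: the end point [e] enters only
    through the closing factor [P^~ e]. *)
Lemma path_weightE P x0 a s e :
  \prod_(i < (size s).+1)
     P (nth x0 (a :: rcons s e) i) (nth x0 (a :: rcons s e) i.+1) =
  path_weight P (P^~ e) a s.
Proof.
elim: s a => [|b s IH] a; first by rewrite big_ord_recl big_ord0 mulr1.
by rewrite big_ord_recl /=; congr (_ * _); rewrite -IH.
Qed.

End ChainWeight.

Lemma path_weight_map (R R' : comNzRingType) (S S' : Type) (h : R -> R')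
    (f : S -> S') P c P' c' x s :
    {morph h : a b / a * b} -> (forall y z, h (P' (f y) (f z)) = P y z) ->
    (forall y, h (c' (f y)) = c y) ->
  h (path_weight P' c' (f x) (map f s)) = path_weight P c x s.
Proof.
by move=> hM hP hc; elim: s x => [|y s IH] x /=; rewrite ?hc // hM hP IH.
Qed.

Section Poset.
Context {R : comNzRingType} {T : finType} (le : rel T).
Hypotheses (le_refl : reflexive le) (le_trans : transitive le)
  (le_anti : antisymmetric le).
Implicit Types (F : {set T}) (P : T -> T -> R) (c u : T -> R) (Q : pred T).

Definition chain F := [forall x in F, forall y in F, le x y || le y x].

Local Notation lt x y := ((x != y) && le x y).

Lemma chain_total F : chain F -> {in F &, total le}.
Proof. by move=> /forall_inP cF x y /cF/forall_inP; apply. Qed.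

Lemma chain_subset F F' : F \subset F' -> chain F' -> chain F.
Proof.
move=> /fintype.subsetP sF /chain_total cF'.
by apply/forall_inP => x /sF xF; apply/forall_inP => y /sF; apply: cF'.
Qed.

Lemma chain_setU1 F x : chain F -> (forall y, y \in F -> lt y x) ->
  chain (x |: F).
Proof.
move=> cF Fx; apply/forall_inP => y /finset.setU1P yF.
apply/forall_inP => z /finset.setU1P zF.
case: yF zF => [->|yF] [->|zF]; rewrite ?le_refl //.
- by have /andP[_ ->] := Fx _ zF; rewrite orbT.
- by have /andP[_ ->] := Fx _ yF.
- exact: chain_total cF _ _ yF zF.
Qed.

Lemma sorted_chain F : chain F -> sorted le (sort le (enum F)).
Proof.
move=> /chain_total cF; apply: (sort_sorted_in cF).
by apply/allP => x; rewrite mem_enum.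
Qed.

Lemma sorted_rcons_trans s x :
  sorted le (rcons s x) = all (le^~ x) s && sorted le s.
Proof. by rewrite !(sorted_pairwise le_trans) pairwise_rcons. Qed.

Lemma sort_chain_setU1 F x : chain F -> (forall y, y \in F -> lt y x) ->
  sort le (enum (x |: F)) = rcons (sort le (enum F)) x.
Proof.
move=> cF Fx.
have xF : x \notin F by apply/negP => /Fx; rewrite eqxx.
apply: (sorted_eq le_trans le_anti).
- exact/sorted_chain/chain_setU1.
- rewrite sorted_rcons_trans sorted_chain // andbT.
  by apply/allP => y; rewrite mem_sort mem_enum => /Fx/andP[].
- rewrite perm_sort perm_sym perm_rcons; apply: uniq_perm.
  + by rewrite /= mem_sort mem_enum xF sort_uniq enum_uniq.
  + exact: enum_uniq.
  + by move=> y; rewrite in_cons mem_sort !mem_enum finset.in_setU1.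
Qed.

Lemma chain_le_last F x0 x : chain F -> x \in F ->
  le x (last x0 (sort le (enum F))).
Proof.
move=> cF xF; have := sorted_chain cF.
have : x \in sort le (enum F) by rewrite mem_sort mem_enum.
case: (lastP (sort le (enum F))) => // s y; rewrite last_rcons mem_rcons in_cons.
rewrite sorted_rcons_trans => /orP[/eqP->//|xs] /andP[/allP sy _].
exact: sy.
Qed.

Definition chain_sum P u Q c : R :=
  \sum_(F : {set T} | chain F && [forall x in F, Q x])
    seq_weight P c (sort le (enum F)) * \prod_(x in F) u x.

(** Chains are grouped by their largest element [x]. As [Q] is closed downwards, the rest is an
    arbitrary chain strictly below [x], now closed by the step [P^~ x]. *)
Lemma chain_sum_rec P u Q c (x0 : T) : (forall x y, le x y -> Q y -> Q x) ->
  chain_sum P u Q c =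
  1 + \sum_(x | Q x) chain_sum P u (fun y => lt y x) (P^~ x) * u x * c x.
Proof.
move=> Qdown; rewrite /chain_sum (bigD1 finset.set0) /=; last first.
  by apply/andP; split; apply/forall_inP => x; rewrite finset.in_set0.
rewrite finset.enum_set0 finset.big_set0 /= mulr1; congr (_ + _).
(* [x0] is only the default of [last]; on a nonempty chain [mx] is the largest element. *)
pose mx F := last x0 (sort le (enum F)).
have mxF F : F != finset.set0 -> mx F \in F.
  move=> F0; have : sort le (enum F) != [::].
    by rewrite -size_eq0 size_sort -cardE finset.cards_eq0.
  rewrite -mem_enum -(mem_sort le) /mx.
  by case: (sort _ _) => //= y s _; rewrite mem_last.
rewrite (partition_big mx Q) /=; last first.
  by move=> F /andP[/andP[_ /forall_inP FQ] /mxF/FQ].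
apply: eq_bigr => x Qx; rewrite !big_distrl /=.
(* The side condition that deleting [x] from [x |: F] gives back [F] encodes that [x] is not in
   [F]. *)
rewrite (reindex_onto (fun F => x |: F) (fun F => F :\ x)) /=; last first.
  by move=> F /andP[/andP[_ /mxF mF] /eqP <-]; rewrite finset.setD1K.
have maxU1 F : chain (x |: F) -> mx (x |: F) == x -> (x |: F) :\ x == F ->
    chain F /\ (forall y, y \in F -> lt y x).
  move=> cF /eqP mF /eqP FF; split.
    exact: chain_subset (finset.subsetUr _ _) cF.
  have xF : x \notin F by rewrite -FF finset.setD11.
  move=> y yF; apply/andP; split; first by apply: contraNneq xF => <-.
  by rewrite -mF; apply: chain_le_last; rewrite // finset.in_setU1 yF orbT.
apply: eq_big => [F|F]; last first.
  move=> /andP[/andP[/andP[/andP[cF _] _] mF] FF].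
  have [{}cF Fx] := maxU1 F cF mF FF.
  have xF : x \notin F by apply/negP => /Fx; rewrite eqxx.
  by rewrite sort_chain_setU1 // seq_weight_rcons finset.big_setU1 //=; ring.
apply/idP/idP => [/andP[/andP[/andP[/andP[cF _] _] mF] FF]|].
  by have [-> /forall_inP] := maxU1 F cF mF FF.
move=> /andP[cF /forall_inP Fx].
have xF : x \notin F by apply/negP => /Fx; rewrite eqxx.
rewrite finset.setU1K // eqxx /mx sort_chain_setU1 // last_rcons eqxx.
rewrite chain_setU1 //.
rewrite !andbT; apply/andP; split; last first.
  by apply/finset.set0Pn; exists x; rewrite finset.setU11.
apply/forall_inP => y /finset.setU1P[->//|/Fx/andP[_ yx]].
exact: Qdown yx Qx.
Qed.

End Poset.

(** * Inversion of chain sums weighted by a conjugated Möbius function *)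

Section Reciprocity.
Context {Q : fieldType} {T : finType} (le : rel T) (bot : T).
Hypotheses (le_refl : reflexive le) (le_trans : transitive le)
  (le_anti : antisymmetric le) (le_bot : forall x, le bot x).

Local Notation lt x y := ((x != y) && le x y).
Local Notation zeta x y := ((le x y)%:R : Q).

Variable mob : T -> T -> Q.
Hypotheses (mob_supp : forall x y, ~~ le x y -> mob x y = 0)
  (mob_zeta : forall x y, \sum_z mob x z * zeta z y = (x == y)%:R).

Definition interval_poly (D : T -> Q) x y : Q :=
  \sum_z mob x z * zeta z y * (D z / D x).

(** A left inverse of a square matrix over a field is also a right inverse. *)
Lemma zeta_mob x y : \sum_z zeta x z * mob z y = (x == y)%:R.
Proof.
pose M f : 'M[Q]_#|T| := \matrix_(i, j) f (enum_val i) (enum_val j).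
have MM f g : M f *m M g = M (fun x y => \sum_z f x z * g z y).
  apply/matrixP => i j; rewrite !mxE.
  rewrite [RHS](reindex _ (onW_bij _ (@enum_val_bij T))).
  by apply: eq_bigr => k _; rewrite !mxE.
have M1 : M (fun x y => (x == y)%:R) = 1%:M.
  by apply/matrixP => i j; rewrite !mxE (inj_eq enum_val_inj).
have : M mob *m M (fun x y => zeta x y) = 1%:M.
  by rewrite MM -M1; apply/matrixP => i j; rewrite !mxE mob_zeta.
move/mulmx1C; rewrite MM -M1 => /matrixP/(_ (enum_rank x) (enum_rank y)).
by rewrite !mxE !enum_rankK.
Qed.

Lemma mob_refl x : mob x x = 1.
Proof.
have := mob_zeta x x; rewrite eqxx (bigD1 x) //= le_refl mulr1 big1 ?addr0 //.
move=> z zx; case: (boolP (le x z)) => [xz|/mob_supp->]; last by rewrite mul0r.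
case: (boolP (le z x)) => [zx'|]; last by rewrite mulr0.
by case/eqP: zx; apply: le_anti; rewrite zx' xz.
Qed.

Lemma interval_poly_supp D x y : ~~ le x y -> interval_poly D x y = 0.
Proof.
move=> xy; apply: big1 => z _.
case: (boolP (le x z)) => [xz|/mob_supp->]; last by rewrite !mul0r.
case: (boolP (le z y)) => [zy|]; last by rewrite mulr0 mul0r.
by rewrite (le_trans xz zy) in xy.
Qed.

Lemma interval_poly_refl D x : D x != 0 -> interval_poly D x x = 1.
Proof.
move=> Dx; rewrite /interval_poly (bigD1 x) //= mob_refl le_refl divff // !mulr1.
rewrite big1 ?addr0 // => z zx.
case: (boolP (le x z)) => [xz|/mob_supp->]; last by rewrite !mul0r.
case: (boolP (le z x)) => [zx'|]; last by rewrite mulr0 mul0r.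
by case/eqP: zx; apply: le_anti; rewrite zx' xz.
Qed.

Variable D : T -> Q.
Hypotheses (D_neq0 : forall x, D x != 0) (D_bot : D bot = 1).

Local Notation P := (interval_poly D).
Local Notation P' := (interval_poly (fun x => (D x)^-1)).

(** In matrices P' = D mu D^-1 zeta, so zeta D^-1 P' = zeta mu D^-1 zeta, and zeta mu = 1. *)
Lemma zeta_interval_poly z y : \sum_x zeta z x * (P' x y / D x) = zeta z y / D z.
Proof.
transitivity (\sum_t (\sum_x zeta z x * mob x t) * (zeta t y / D t)).
  under [RHS]eq_bigr do rewrite mulr_suml.
  rewrite exchange_big; apply: eq_bigr => x _ /=.
  rewrite mulr_suml mulr_sumr; apply: eq_bigr => t _.
  by field; rewrite !D_neq0 oner_neq0.
under eq_bigr do rewrite zeta_mob.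
rewrite (bigD1 z) //= eqxx mul1r big1 ?addr0 // => t tz.
by rewrite eq_sym (negPf tz) mul0r.
Qed.

(** With P = D^-1 mu D zeta, [zeta_interval_poly] turns P D^-1 P' into D^-1 mu zeta = D^-1. *)
Lemma interval_polyV w y : \sum_x P w x * (P' x y / D x) = (w == y)%:R / D w.
Proof.
transitivity (\sum_z mob w z * (D z / D w) * (\sum_x zeta z x * (P' x y / D x))).
  under [RHS]eq_bigr do rewrite mulr_sumr.
  rewrite exchange_big; apply: eq_bigr => x _ /=.
  by rewrite mulr_suml; apply: eq_bigr => t _; ring.
rewrite -mob_zeta mulr_suml; apply: eq_bigr => z _.
rewrite zeta_interval_poly; move: (zeta z y) => c.
by field; rewrite !D_neq0 ?oner_neq0.
Qed.

Variables (u a a' : T -> Q).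
Hypotheses
  (aE : forall y, a y = 1 + \sum_(x | lt x y) a x * u x * P x y)
  (a'E : forall y, a' y = 1 + \sum_(x | lt x y) a' x * (- 1 - u x) * P' x y).

(** Unitriangularity turns the strict sums of the recurrences into full matrix products. *)
Lemma sum_lt_full (P0 : T -> T -> Q) f y : P0 y y = 1 ->
  (forall x, ~~ le x y -> P0 x y = 0) ->
  \sum_(x | lt x y) f x * P0 x y = \sum_x f x * P0 x y - f y.
Proof.
move=> P1 P0E; rewrite [in RHS](bigD1 y) //= P1 mulr1 addrC addrK.
rewrite [RHS](bigID (le^~ y)) /= [X in _ + X]big1 ?addr0 // => x /andP[_ xy].
by rewrite P0E ?mulr0.
Qed.

Lemma chain_reciprocity y : a' y = a y / D y.
Proof.
have [n] := ubnP #|[pred x | lt x y]|; elim: n y => // n IH y yn.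
have IHy x : lt x y -> a' x = a x / D x.
  move=> xy; apply: IH; apply: leq_trans (yn : (_ <= n)%N).
  apply: proper_card; apply/properP; split.
    apply/fintype.subsetP => z; rewrite !inE => /andP[zx lezx].
    have /andP[nxy lexy] := xy; rewrite (le_trans lezx lexy) andbT.
    by apply: contraNneq zx => zy; apply/eqP/le_anti; rewrite lezx zy.
  by exists x; rewrite !inE // eqxx.
rewrite a'E (eq_bigr (fun x => (- (a x * (1 + u x) / D x)) * P' x y)); last first.
  by move=> x /IHy ->; ring.
rewrite (sum_lt_full (P0 := P')); last 2 first.
- by apply: interval_poly_refl; rewrite invr_eq0.
- by move=> x; apply: interval_poly_supp.
(* The constant 1 is written as the row [zeta bot], so that the whole right-hand side can be
   multiplied by D^-1 P'. *)
have a1u x : a x * (1 + u x) = zeta bot x + \sum_w a w * u w * P w x.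
  rewrite le_bot mulr1n mulrDr mulr1 {1}aE (sum_lt_full (P0 := P)).
  - by ring.
  - exact: interval_poly_refl.
  - by move=> z; apply: interval_poly_supp.
(* Under D^-1 P' the row [zeta bot] becomes 1 because [D bot = 1], and P D^-1 P' = D^-1 leaves only
   the term w = y. *)
have -> : \sum_x - (a x * (1 + u x) / D x) * P' x y = - (1 + a y * u y / D y).
  transitivity (- (\sum_x zeta bot x * (P' x y / D x) +
      \sum_w a w * u w * (\sum_x P w x * (P' x y / D x)))).
    under [X in _ = - (_ + X)]eq_bigr do rewrite mulr_sumr.
    rewrite exchange_big -big_split -sumrN; apply: eq_bigr => x _ /=.
    under [X in _ = - (_ + X)]eq_bigr do rewrite mulrA.
    by rewrite a1u -mulr_suml; move: (zeta bot x) => z0; ring.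
  rewrite zeta_interval_poly le_bot D_bot divr1; congr (- (_ + _)).
  under eq_bigr do rewrite interval_polyV.
  rewrite (bigD1 y) //= eqxx mul1r big1 ?addr0 // => w wy.
  by rewrite (negPf wy) mul0r mulr0.
by ring.
Qed.

End Reciprocity.

(** * Rational functions *)

Section RationalFunctions.
Context {n : nat} (i : 'I_n).
Local Notation Y := (tofrac 'X_i : {fraction {mpoly int[n]}}).

(** Substituting the single ['X] for every variable maps q(Y) back to q, so q(Y) vanishes only for q
    = 0. *)
Lemma horner_tofracX_neq0 (q : {poly int}) : q != 0 -> (map_poly intr q).[Y] != 0.
Proof.
have -> : map_poly (intr : int -> {fraction {mpoly int[n]}}) q =
          map_poly (@tofrac {mpoly int[n]}) (map_poly intr q).
  by rewrite -map_poly_comp; apply: eq_map_poly => c /=; rewrite rmorph_int.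
pose phi : {rmorphism {mpoly int[n]} -> {poly int}} := mmap intr (fun=> 'X).
rewrite horner_map tofrac_eq0; apply: contraNneq => /(congr1 phi).
rewrite -horner_map /= mmapX mmap1U rmorph0 -map_poly_comp.
rewrite (eq_map_poly (g := polyC)) => [|c] /=; last first.
  by rewrite rmorph_int -[in RHS](intz c) rmorph_int.
by rewrite -[_.['X]]/(q \Po 'X) comp_polyXr => ->.
Qed.

Lemma tofracX_neq0 : Y != 0.
Proof.
have := horner_tofracX_neq0 (monic_neq0 (monicX int)).
by rewrite map_polyX hornerX.
Qed.

Lemma tofracX_neq1 : Y != 1.
Proof.
have := horner_tofracX_neq0 (monic_neq0 (monicXsubC (1 : int))).
by rewrite rmorphB /= map_polyX map_polyC hornerXsubC subr_eq0.
Qed.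

(** Let [r] be q with its coefficients reversed. Its top coefficient is q(0), and r(Y) = Y^(deg q)
    q(Y^-1), so [horner_tofracX_neq0] applies to [r]. *)
Lemma horner_tofracXV_neq0 (q : {poly int}) : q.[0] != 0 ->
  (map_poly intr q).[Y^-1] != 0.
Proof.
move=> q0; have qn0 : q != 0 by apply: contraNneq q0 => ->; rewrite horner0.
pose r := \poly_(j < size q) q`_(size q - j.+1).
have r0 : r != 0.
  apply: contraNneq q0 => /(congr1 (coefp (size q).-1)).
  rewrite /= coef0 coef_poly.
  by rewrite prednK ?leqnn ?size_poly_gt0 // subnn horner_coef0 => ->.
apply: contraNneq (horner_tofracX_neq0 r0) => qY0.
suff -> : (map_poly intr r).[Y] = Y ^+ (size q).-1 * (map_poly intr q).[Y^-1].
  by rewrite qY0 mulr0.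
rewrite (@horner_coef_wide _ (size q)) ?(leq_trans (size_poly _ _)) ?size_poly //.
rewrite (@horner_coef_wide _ (size q) (map_poly _ q)) ?size_poly //.
rewrite (reindex_inj rev_ord_inj) mulr_sumr; apply: eq_bigr => j _ /=.
have jq := ltn_ord j.
rewrite !coef_map coef_poly /=.
rewrite ltn_subrL /= (leq_ltn_trans _ jq) // subnSK // subKn ?(ltnW jq) //.
rewrite mulrCA; congr (_ * _); rewrite exprVn.
have -> : (size q).-1 = (size q - j.+1 + j)%N.
  by apply: succn_inj; rewrite -addnS subnK // prednK // (leq_trans _ jq).
by rewrite exprD mulfK ?expf_neq0 ?tofracX_neq0.
Qed.

End RationalFunctions.

(** * Moebius functions of intervals and the geometry of flats *)

Local Open Scope fset_scope.
Local Open Scope classical_set_scope.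
Local Open Scope ring_scope.

Section Mobius.
Context {disp : Order.disp_t} {T : porderType disp}.
Implicit Types (L I : {fset T}).

(** The recursion at [b] visits only elements between [a] and [b], and these are common to [I] and
    [L]. *)
Lemma mobius_convex L I a b : a \in I -> b \in I -> {subset I <= L} ->
    (forall z, z \in L -> (a <= z <= b)%O -> z \in I) ->
  mobius I a b = mobius L a b.
Proof.
move=> aI bI IL; have [n] := ubnP #|` [fset z in L | (z < b)%O]|.
elim: n b bI => // n IH b bI bn conv; rewrite !mobiusE ?IL //.
case: ifP => // _; congr (- _).
rewrite [LHS]big_fset_condE [RHS]big_fset_condE /=.
have -> : [fset z in I | (a <= z < b)%O] = [fset z in L | (a <= z < b)%O].
  apply/fsetP => z; rewrite !inE /=; apply: andb_id2r => /andP[az zb].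
  by apply/idP/idP => [/IL//|zL]; apply: conv; rewrite // az ltW.
rewrite big_seq [RHS]big_seq; apply: eq_bigr => z; rewrite !inE /=.
move=> /and3P[zL az zb]; apply: IH.
- by apply: conv; rewrite // az ltW.
- apply: leq_trans (bn : (_ <= n)%N).
  apply: fproper_ltn_card; rewrite fproperEneq; apply/andP; split.
    apply/eqP => E; have : z \in [fset y in L | (y < b)%O] by rewrite !inE zL.
    by rewrite -E !inE ltxx andbF.
  by apply/fsubsetP => y; rewrite !inE => /andP[-> /lt_trans]; apply.
- move=> y yL /andP[ay yz]; apply: conv; rewrite // ay.
  exact: le_trans yz (ltW zb).
Qed.

Lemma sum_mobius L a b : a \in L -> b \in L -> (a <= b)%O ->
  \sum_(z <- L | (a <= z <= b)%O) mobius L a z = (a == b)%:R.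
Proof.
move=> aL bL ab.
rewrite big_mkcond (bigD1_seq b) ?fset_uniq //= ab lexx /= -big_mkcondr.
rewrite (mobiusE _ bL) eq_sym [X in _ + X](eq_bigl (fun z => (a <= z < b)%O)).
  case: eqVneq => [<-|_]; last by rewrite addNr.
  by rewrite big1 ?addr0 // => z /andP[az /(le_lt_trans az)]; rewrite ltxx.
by move=> z; rewrite lt_neqAle; case: (z != b); rewrite ?andbF ?andbT.
Qed.

End Mobius.

Section Arrangement.
Context {K : fieldType} {d : nat}.
Local Notation revset := ((set 'rV[K]_d)^d)%type.
Implicit Types (x y z H : set 'rV[K]_d) (A B : {fset set 'rV[K]_d}).
Local Notation lat A := (intposet setT A).

Lemma subset_flat p (U W : {vspace 'rV[K]_d}) :
  flat p U `<=` flat p W -> (U <= W)%VS.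
Proof.
move=> UW; apply/subvP => v vU; have := UW (v + p).
by rewrite /flat /= addrK; apply.
Qed.

Lemma flatI p (U W : {vspace 'rV[K]_d}) :
  flat p U `&` flat p W = flat p (U :&: W)%VS.
Proof.
apply/seteqP; split => v; rewrite /flat /= memv_cap; first by case=> -> ->.
by move/andP.
Qed.

Lemma flatT (p : 'rV[K]_d) : flat p fullv = setT.
Proof. by apply/seteqP; split => v // _; rewrite /flat /= memvf. Qed.

Lemma affdimT : affdim (setT : set 'rV[K]_d) = d.
Proof. by rewrite -(flatT 0) affdim_flat dimvf /dim /= mul1n. Qed.

Lemma hyperplane_flat p H : hyperplane H -> H p -> exists W, H = flat p W.
Proof.
move=> [q [W [-> _]]]; rewrite /flat /= => pq; exists W.
apply/seteqP; split => v /= vW.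
  suff -> : v - p = (v - q) - (p - q) by rewrite rpredB.
  by rewrite opprB addrA subrK.
suff -> : v - q = (v - p) + (p - q) by rewrite rpredD.
by rewrite addrA subrK.
Qed.

Lemma hyperplane_neqT H : hyperplane H -> H != setT.
Proof.
move=> [p [W [-> dimW]]]; apply/eqP => E.
have := affdimT; rewrite -E affdim_flat => Wd; move: dimW; rewrite Wd.
by move/eqP; rewrite eqn_leq ltnn.
Qed.

(** Based at the common point [p], intersecting hyperplanes amounts to intersecting their direction
    spaces. *)
Lemma hcap_flat p A : arrangement A -> hcap A p -> exists W, hcap A = flat p W.
Proof.
move=> arrA; have : {subset A <= A} by [].
elim/finSet_rect: {1 3 4}A => B IH BA pB.
have [->|[H HB]] := fset_0Vmem B.
  by exists fullv; rewrite flatT; apply/seteqP; split => // v _ H /=; rewrite inE.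
have [W HW] := hyperplane_flat (arrA _ (BA _ HB)) (pB _ HB).
have [|||U BU] := IH (B `\ H)%fset.
- exact: fproperD1.
- by move=> G; rewrite inE => /andP[_ /BA].
- by move=> G /=; rewrite inE => /andP[_ /pB].
exists (W :&: U)%VS; rewrite -flatI -HW -BU.
apply/seteqP; split => [v vB|v [vH vB] G /= GB].
  by split; [exact: vB | move=> G /=; rewrite inE => /andP[_ /vB]].
have [->//|GH] := eqVneq G H.
by apply: vB; rewrite /= in_fsetD1 GH.
Qed.

Lemma hcapS A B : {subset B <= A} -> hcap A `<=` hcap B.
Proof. by move=> BA v vA H /BA; apply: vA. Qed.

Lemma intposetP E A x : reflect
  (exists B, [/\ {subset B <= A}, x = E `&` hcap B & x != set0])
  (x \in intposet E A).
Proof.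
apply: (iffP idP) => [|[B [BA xB x0]]].
  rewrite !inE /= => /andP[/imfsetP[B /=]].
  by rewrite fpowersetE => /fsubsetP BA ->; exists B.
rewrite !inE /= x0 andbT; apply/imfsetP; exists B => //=.
by rewrite fpowersetE; apply/fsubsetP.
Qed.

Lemma latP A x : reflect
  (exists B, [/\ {subset B <= A}, x = hcap B & x != set0]) (x \in lat A).
Proof.
by apply: (iffP (intposetP _ _ _)) => -[B [BA xB x0]]; exists B; split;
  rewrite // xB setTI.
Qed.

Lemma mem_localization A x H :
  (H \in localization A x) = (H \in A) && `[< x `<=` H >].
Proof. by rewrite !inE. Qed.

Lemma restrictionP A x G : reflect
  (exists H, [/\ H \in A, ~ x `<=` H, H `&` x != set0 & G = H `&` x])
  (G \in restriction A x).
Proof.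
apply: (iffP (imfsetP _ _ _ _)) => [[H /= HA ->]|[H [HA xH Hx ->]]].
  move: HA; rewrite !inE /= negb_and.
  move=> /andP[/andP[/orP[/negP//|/asboolPn xH] HA] Hx].
  by exists H.
exists H => //=; rewrite !inE /= HA Hx /= !andbT; exact/asboolPn.
Qed.

Section Central.
Variables (A : {fset set 'rV[K]_d}).
Hypotheses (arrA : arrangement A).

(** Hyperplanes are proper and nonempty, so none is lost. This identifies the first factor of a flag
    product with the denominator of its truncation. *)
Lemma restrictionT B : {subset B <= A} -> restriction B setT = B.
Proof.
move=> BA; apply/fsetP => G; apply/restrictionP/idP => [[H [HB _ _ ->]]|GB].
  by rewrite setIT.
have hG := arrA (BA _ GB); exists G; split; rewrite ?setIT //.
  by move=> TG; case/eqP: (hyperplane_neqT hG); apply/seteqP; split.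
have [p [W [-> _]]] := hG; apply/set0P; exists p.
by rewrite /flat /= subrr mem0v.
Qed.

Hypothesis cA : central A.

Lemma setT_lat : setT \in lat A.
Proof.
apply/latP; exists fset0; split=> //.
- by apply/seteqP; split => // v _ H /=; rewrite inE.
- by apply/set0P; exists 0.
Qed.

Lemma hcap_le x : x \in lat A -> hcap A `<=` x.
Proof. by move/latP => [B [BA -> _]]; apply: hcapS. Qed.

(** Traces on [x] come from hyperplanes containing [y]. Conversely, a hyperplane containing [z]
    contains [y], and either contains [x], so that it imposes nothing there, or has a trace in the
    restriction. *)
Lemma intposet_interval x y : x \in lat A -> y \in lat A -> y `<=` x ->
  intposet x (restriction (localization A y) x) =
  [fset z : revset in lat A | ((x : revset) <= z <= (y : revset))%O].
Proof.
move=> /latP[C [CA xC x0]] /latP[_ [_ _ y0]] yx; apply/fsetP => z.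
transitivity [&& z \in lat A, `[< z `<=` x >] & `[< y `<=` z >]]; last first.
  by rewrite [in RHS]inE.
apply/idP/idP.
  move=> /intposetP[B' [BR zE z0]].
  (* [B] lifts the traces in [B'] to hyperplanes; together with the family [C] cutting out [x] it
     cuts out [z]. *)
  pose B := [fset H in localization A y | H `&` x \in B'].
  have memB H : (H \in B) = [&& H \in A, `[< y `<=` H >] & H `&` x \in B'].
    by rewrite !inE /= andbA.
  have zB : z = x `&` hcap B.
    rewrite {1}zE; apply/seteqP; split => v [vx vB]; split=> // H /=.
      by rewrite memB => /and3P[_ _ HB']; have [] := vB _ HB'.
    move=> HB'; have /restrictionP[G [Gl _ _ HE]] := BR _ HB'.
    rewrite HE; split=> //; apply: vB.
    by move: Gl; rewrite mem_localization /= memB -HE HB' andbT.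
  apply/and3P; split.
  - apply/latP; exists (C `|` B)%fset; split=> //.
      by move=> H; rewrite in_fsetU memB => /orP[/CA//|/and3P[]].
    rewrite zB {1}xC; apply/seteqP; split => [v [vC vB] H|v vCB] /=.
      by rewrite in_fsetU => /orP[/vC|/vB].
    by split=> H /= HH; apply: vCB; rewrite /= in_fsetU HH ?orbT.
  - by apply/asboolP; rewrite zB; apply: subIsetl.
  - apply/asboolP; rewrite zB => v vy; split; first exact: yx.
    by move=> H /=; rewrite memB => /and3P[_ /asboolP yH _]; apply: yH.
move=> /and3P[/latP[B [BA zB z0]] /asboolP zx /asboolP yz].
apply/intposetP.
(* The largest candidate: all traces that contain [z]. *)
pose B' := [fset H in restriction (localization A y) x | `[< z `<=` H >]].
have memB' H : (H \in B') =
    (H \in restriction (localization A y) x) && `[< z `<=` H >] by rewrite !inE.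
exists B'; split=> //.
  by move=> H; rewrite memB' => /andP[].
apply/seteqP; split => [v vz|v [vx vB]].
  by split; [exact: zx | move=> H /=; rewrite memB' => /andP[_ /asboolP]; apply].
rewrite zB => H /= HB.
have zH : z `<=` H by rewrite zB => w; apply.
have yH : y `<=` H by move=> w /yz/zH.
have [xH|xH] := pselect (x `<=` H); first exact: xH.
suff /vB [] : H `&` x \in B' by [].
rewrite memB'; apply/andP; split; last by apply/asboolP => w wz; split; auto.
apply/restrictionP; exists H; split=> //.
  by rewrite mem_localization BA //; apply/asboolP.
by apply/set0P; have /set0P[w wy] := y0; exists w; split; auto.
Qed.

Lemma lat_flat p x : hcap A p -> x \in lat A -> exists W, x = flat p W.
Proof.
move=> pA /latP[B [BA -> _]]; apply: hcap_flat; last exact: (hcapS BA).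
by move=> H /BA/arrA.
Qed.

Lemma affdim_mono x y : x \in lat A -> y \in lat A -> y `<=` x ->
  (affdim y <= affdim x)%N.
Proof.
have [p pA] := cA.
move=> /(lat_flat pA)[U ->] /(lat_flat pA)[W ->] /subset_flat WU.
by rewrite !affdim_flat dimvS.
Qed.

(** Subtraction in [codim] is truncated, so additivity rests on the monotonicity of the
    dimension. *)
Lemma codimD x y : x \in lat A -> y \in lat A -> y `<=` x ->
  (codim setT y = codim setT x + codim x y)%N.
Proof.
move=> xL yL yx; rewrite /codim addnBA ?affdim_mono // subnK //.
by apply: affdim_mono; rewrite ?setT_lat.
Qed.

Lemma codimT_eq0 x : x \in lat A -> (codim setT x == 0%N) = (x == setT).
Proof.
have [p pA] := cA; move=> /(lat_flat pA)[W ->].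
rewrite /codim affdimT affdim_flat subn_eq0; apply/idP/eqP => [dW|].
  rewrite -(flatT p); congr flat; apply/eqP; rewrite eqEdim subvf /=.
  by rewrite dimvf /dim /= mul1n.
by move=> /(congr1 affdim); rewrite affdimT affdim_flat => ->.
Qed.

(** At 0 only terms of codimension 0 survive, that is, the whole space, whose Möbius value is 1. *)
Lemma horner0_poincare : (poincare setT A).[0] = 1.
Proof.
rewrite /poincare horner_sum (bigD1_seq (setT : revset)) ?fset_uniq ?setT_lat //=.
rewrite mobiusE ?setT_lat // eqxx /codim subnn expr0 mulr1 hornerC.
rewrite big_seq_cond big1 ?addr0 // => x /andP[xL xT].
rewrite hornerM horner_exp hornerN hornerX oppr0 expr0n codimT_eq0 //.
by rewrite (negPf xT) mulr0.
Qed.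

End Central.
End Arrangement.

(** * Flags of the intersection poset *)

Section Flags.
Context {K : fieldType} {d : nat} (A : {fset set 'rV[K]_d}).
Hypotheses (arrA : arrangement A) (cA : central A).
Local Notation revset := ((set 'rV[K]_d)^d)%type.
Local Notation lat := (intposet setT A).
Implicit Types (x y z : lat).

Definition lat_le x y : bool := ((\val x : revset) <= \val y)%O.

Lemma lat_leP x y : reflect (val y `<=` val x) (lat_le x y).
Proof. exact: asboolP. Qed.

Lemma lat_le_refl : reflexive lat_le.
Proof. by move=> x; apply: lexx. Qed.

Lemma lat_le_trans : transitive lat_le.
Proof. by move=> y x z; apply: le_trans. Qed.

Lemma lat_le_anti : antisymmetric lat_le.
Proof. by move=> x y xy; apply/val_inj/le_anti. Qed.

Definition lat_bot : lat := FSetSub (setT_lat A).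

Lemma lat_le_bot x : lat_le lat_bot x.
Proof. exact/lat_leP. Qed.

Lemma lat_le_top x : lat_le x (arr_top cA).
Proof. exact/lat_leP/(hcap_le (fsvalP x)). Qed.

Definition interval_poincare (x y : set 'rV[K]_d) : {poly int} :=
  poincare x (restriction (localization A y) x).

Lemma flag_seqE (F : {set lat}) : flag_seq F = map val (sort lat_le (enum F)).
Proof. exact: sort_map. Qed.

Lemma localization_arr (x : set 'rV[K]_d) : arrangement (localization A x).
Proof. by move=> H; rewrite mem_localization => /andP[/arrA]. Qed.

Lemma localization_central (x : set 'rV[K]_d) : central (localization A x).
Proof.
have [p pA] := cA; exists p.
by apply: (hcapS _ pA) => H; rewrite mem_localization => /andP[].
Qed.

(** Each hyperplane of [A] contains both [set0] and [hcap A], so either localization is [A]. The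
    formal end of a flag thus becomes the top element. *)
Lemma interval_poincare_set0 (x : set 'rV[K]_d) :
  interval_poincare x set0 = interval_poincare x (hcap A).
Proof.
suff E : localization A set0 = localization A (hcap A).
  by rewrite /interval_poincare E.
apply/fsetP => H; rewrite !mem_localization; apply: andb_id2l => HA.
by apply/asboolP/asboolP => _ v //; apply.
Qed.

(** * Evaluation at a point [X] of a field, and the recurrence for the flag series *)

Section Evaluation.
Variables (Q : fieldType) (X : Q).
Hypothesis X_neq0 : X != 0.
Hypothesis X_nonroot :
  forall q : {poly int}, q.[0] = 1 -> (map_poly intr q).[X] != 0.

Definition lat_mob x y : Q :=
  if lat_le x y then (mobius lat (\val x : revset) (\val y))%:~R else 0.

Definition lat_weight x : Q := (- X) ^+ codim setT (\val x).

Lemma lat_mob_supp x y : ~~ lat_le x y -> lat_mob x y = 0.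
Proof. by rewrite /lat_mob => /negPf->. Qed.

Lemma lat_mob_zeta x y : \sum_z lat_mob x z * (lat_le z y)%:R = (x == y)%:R.
Proof.
case: (boolP (lat_le x y)) => xy; last first.
  rewrite big1 => [|z _]; first by case: eqVneq xy => // ->; rewrite lat_le_refl.
  case: (boolP (lat_le x z)) => [xz|/lat_mob_supp->]; last by rewrite mul0r.
  case: (boolP (lat_le z y)) => [zy|]; last by rewrite mulr0.
  by rewrite (lat_le_trans xz zy) in xy.
have := sum_mobius (fsvalP x) (fsvalP y) xy.
rewrite (inj_eq val_inj) big_seq_fsetE /= => /(congr1 (intr : int -> Q)).
rewrite rmorph_nat => <-; rewrite rmorph_sum [RHS]big_mkcond /=.
apply: eq_bigr => z _; rewrite /lat_mob -/(lat_le x z) -/(lat_le z y).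
by case: (lat_le x z); case: (lat_le z y); rewrite ?mulr1 ?mulr0 ?mul0r.
Qed.

(** The bridge from arrangements to posets: the flats of the restricted localization form an
    interval of [lat], and [mobius_convex] lets their Möbius function be computed in [lat]. *)
Lemma horner_interval_poincare x y : lat_le x y ->
  (map_poly intr (interval_poincare (\val x) (\val y))).[X] =
  interval_poly lat_le lat_mob lat_weight x y.
Proof.
move=> xy; have /lat_leP yx := xy.
rewrite /interval_poincare /poincare (intposet_interval (fsvalP x) (fsvalP y) yx).
set I := [fset _ | _ in _]%fset.
have memI w : (w \in I) = (w \in lat) && ((\val x : revset) <= w <= (\val y))%O.
  by rewrite inE.
rewrite rmorph_sum horner_sum /= {1}/I -big_fset_condE big_seq_fsetE.
rewrite big_mkcond /=.
apply: eq_bigr => z _; rewrite -/(lat_le x z) -/(lat_le z y) /lat_mob.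
case: (boolP (lat_le x z)) => [xz|]; last by rewrite !mul0r.
case: (boolP (lat_le z y)) => [zy|]; last by rewrite mulr0 mul0r.
rewrite /= mulr1n mulr1 (@mobius_convex _ _ lat).
- rewrite rmorphM rmorphXn rmorphN /= map_polyX map_polyC hornerM horner_exp.
  rewrite hornerN hornerX hornerC; congr (_ * _).
  have /lat_leP zx := xz.
  (* The codimension inside [x] is a difference of ranks, which gives the quotient of the weights of
     [z] and [x]. *)
  rewrite /lat_weight (codimD arrA cA (fsvalP x) (fsvalP z) zx).
  by rewrite exprD mulrAC divff ?mul1r // expf_neq0 ?oppr_eq0.
- by rewrite memI fsvalP lexx; apply: xy.
- by rewrite memI fsvalP /=; apply/andP.
- by move=> w; rewrite memI => /andP[].
- move=> w wL /andP[xw wz]; rewrite memI wL xw /=; exact: le_trans wz zy.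
Qed.

(** The denominator is the factor leading from [setT] to the least element of the flag, so it
    cancels the first factor. *)
Lemma trunc_flag_poincareE (F : {set lat}) :
  trunc_flag_poincare F X =
  seq_weight
    (fun x y => (map_poly intr (interval_poincare (\val x) (\val y))).[X])
    (fun x => (map_poly intr (interval_poincare (\val x) (hcap A))).[X])
    (sort lat_le (enum F)).
Proof.
have poincareT (x : set 'rV[K]_d) :
    interval_poincare setT x = poincare setT (localization A x).
  rewrite /interval_poincare (restrictionT arrA) // => H.
  by rewrite mem_localization => /andP[].
have nz (x : set 'rV[K]_d) :
    (map_poly intr (poincare setT (localization A x))).[X] != 0.
  apply/X_nonroot/horner0_poincare; first exact: localization_arr.
  exact: localization_central.
rewrite /trunc_flag_poincare /flag_poincare /flag_min.
have -> : #|F| = size (flag_seq F) by rewrite flag_seqE size_map size_sort cardE.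
rewrite -/(interval_poincare _ _) (path_weightE interval_poincare) flag_seqE.
(* For the empty flag [flag_min] is the default [set0], and numerator and denominator coincide. *)
case: (sort _ _) => [|x s] /=; first by rewrite poincareT divff.
rewrite poincareT rmorphM /= hornerM mulrAC divff // mul1r.
apply: (path_weight_map (h := fun q : {poly int} => (map_poly intr q).[X])).
- by move=> a b; rewrite rmorphM hornerM.
- by move=> y z.
- by move=> y; rewrite interval_poincare_set0.
Qed.

Variable T : lat -> Q.
Local Notation u := (fun x => T x / (1 - T x)).
Local Notation P := (interval_poly lat_le lat_mob lat_weight).

(** This is [a y] of the overview. *)
Definition lower_mfHP y : Q :=
  let p x z := (map_poly intr (interval_poincare (\val x) (\val z))).[X] in
  chain_sum lat_le p u (fun x => (x != y) && lat_le x y) (p^~ y).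

Lemma lower_mfHPE y : lower_mfHP y =
  1 + \sum_(x | (x != y) && lat_le x y) lower_mfHP x * u x * P x y.
Proof.
rewrite {1}/lower_mfHP.
rewrite (chain_sum_rec lat_le_refl lat_le_trans lat_le_anti _ _ _ y); last first.
  move=> x z xz /andP[zy lezy]; rewrite (lat_le_trans xz lezy) andbT.
  apply: contraNneq zy => xy; apply/eqP/lat_le_anti.
  by rewrite lezy -xy xz.
by congr (_ + _); apply: eq_bigr => x /andP[_ /horner_interval_poincare ->].
Qed.

(** Chains avoiding the top element sum to [lower_mfHP] at the top; adjoining the top to them
    multiplies this by its [u]. *)
Lemma mfHPE : mfHP X T = lower_mfHP (arr_top cA) * (1 + u (arr_top cA)).
Proof.
set top := arr_top cA.
pose p (x y : lat) := (map_poly intr (interval_poincare (\val x) (\val y))).[X].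
transitivity (chain_sum lat_le p u predT (p^~ top)).
  apply: eq_big => [F|F _]; last by rewrite trunc_flag_poincareE.
  by rewrite [X in _ && X](introT forallP) ?andbT // => x; rewrite implybT.
rewrite (chain_sum_rec lat_le_refl lat_le_trans lat_le_anti _ _ _ top) //.
rewrite (bigD1 top) //= -/(lower_mfHP top).
have -> : p top top = 1.
  rewrite /p horner_interval_poincare ?lat_le_refl // interval_poly_refl //.
  - exact: lat_le_refl.
  - exact: lat_le_anti.
  - exact: lat_mob_supp.
  - exact: lat_mob_zeta.
  - by rewrite expf_neq0 ?oppr_eq0.
have -> : \sum_(x | x != top) chain_sum lat_le p u
      (fun y => (y != x) && lat_le y x) (p^~ x) * u x * p x top =
    lower_mfHP top - 1.
  rewrite lower_mfHPE [RHS]addrC addKr; apply: eq_big => [x|x _].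
    by rewrite lat_le_top andbT.
  congr (_ * _); exact/horner_interval_poincare/lat_le_top.
by move: (lower_mfHP top) (u top) => l v; ring.
Qed.

End Evaluation.

Lemma mfHP_reciprocity (Q : fieldType) (X : Q) (T : lat -> Q) :
    X != 0 -> (forall x, T x != 0) -> (forall x, T x != 1) ->
    (forall q : {poly int}, q.[0] = 1 -> (map_poly intr q).[X] != 0) ->
    (forall q : {poly int}, q.[0] = 1 -> (map_poly intr q).[X^-1] != 0) ->
  mfHP X^-1 (fun x => (T x)^-1) =
  - (- X) ^- arr_rank A * T (arr_top cA) * mfHP X T.
Proof.
move=> X0 T0 T1 Xnr XVnr; have XV0 : X^-1 != 0 by rewrite invr_eq0.
have uV x : (T x)^-1 / (1 - (T x)^-1) = - 1 - T x / (1 - T x).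
  have := T1 x; rewrite -subr_eq0 => Tx1.
  have Tx1' : 1 - T x != 0 by rewrite -oppr_eq0 opprB.
  by field; rewrite T0 Tx1 Tx1'.
have D0 x : lat_weight X x != 0 by rewrite expf_neq0 ?oppr_eq0.
have D1 : lat_weight X lat_bot = 1 by rewrite /lat_weight /codim subnn.
(* As -(X^-1) = (-X)^-1, inverting [X] inverts [lat_weight]; this is the recurrence [a'E] of
   [chain_reciprocity]. *)
have lowerV y : lower_mfHP X^-1 (fun x => (T x)^-1) y =
    1 + \sum_(x | (x != y) && lat_le x y)
      lower_mfHP X^-1 (fun x => (T x)^-1) x * (- 1 - T x / (1 - T x)) *
      interval_poly lat_le (@lat_mob Q) (fun z => (lat_weight X z)^-1) x y.
  rewrite lower_mfHPE //; congr (_ + _); apply: eq_bigr => x _.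
  rewrite uV; congr (_ * _); apply: eq_bigr => z _; congr (_ * (_ / _));
  by rewrite /lat_weight -invrN exprVn.
have := chain_reciprocity lat_le_refl lat_le_trans lat_le_anti lat_le_bot
  (@lat_mob_supp Q) (@lat_mob_zeta Q)
  D0 D1 (lower_mfHPE X0 T) lowerV (arr_top cA).
(* At the top, 1 + u = 1/(1 - T) while 1 + (-1 - u) = -T/(1 - T); their quotient is the factor
   -T. *)
rewrite !mfHPE // => ->; rewrite uV /arr_rank -/(lat_weight X (arr_top cA)).
have := T1 (arr_top cA); rewrite eq_sym -subr_eq0.
move: (lower_mfHP _ _ _) (T _) (lat_weight X _) (D0 (arr_top cA)).
by move=> l t D' D'0 t1; field; rewrite D'0 t1.
Qed.

End Flags.

(** * Specialization to the indeterminates of the rational function field *)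

Theorem corollary1p5 (K : fieldType) (d : nat) (A : {fset set 'rV[K]_d})
    (charK : [pchar K] =i pred0) (arrA : arrangement A) (cA : central A) :
  mfHP (varX A)^-1 (fun x => (varT x)^-1) =
  - (- varX A) ^- arr_rank A * varT (arr_top cA) * mfHP (varX A) (@varT K d A).
Proof.
apply: mfHP_reciprocity => //.
- exact: tofracX_neq0.
- by move=> x; apply: tofracX_neq0.
- by move=> x; apply: tofracX_neq1.
- move=> q q0; apply: horner_tofracX_neq0.
  by apply: contra_eq_neq q0 => ->; rewrite horner0 eq_sym oner_neq0.
- by move=> q q0; apply: horner_tofracXV_neq0; rewrite q0 oner_neq0.
Qed.
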